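(* Let $\mathbb{K}$ be a field, $S=\mathbb{K}[x_1,\dots,x_n]$ standard graded, and $\Delta$ a $1$-dimensional simplicial complex on $[n]$ with $\{i\}\in\Delta$ for all $i$. Fix a monomial order $\tau$ in which $x_1$ is the largest variable. Let $I\subset S$ be a homogeneous ideal with $\operatorname{in}_\tau(I)=I_\Delta$, and let $\{f_F: F\text{ a minimal non-face of }\Delta\}$ be a reduced homogeneous Gröbner basis of $I$ with $\operatorname{in}_\tau(f_F)=\mathbf{x}_F$. If the vertex $1$ is not a leaf of $\Delta$, then $P_1=[1:0:\dots:0]$ lies in $\operatorname{Proj} S/I$ and is a singular point of it; more precisely the Jacobian matrix of the $f_F$ at $P_1$ has rank at most $n-3$.
   Context: For $F\subseteq[n]$, $\mathbf{x}_F=\prod_{i\in F}x_i$; $I_\Delta=(\mathbf{x}_F:F\notin\Delta)$; a minimal non-face is a non-face all of whose proper subsets are faces. A leaf of $\Delta$ is a vertex contained in exactly one maximal face (maximal under inclusion). A reduced Gröbner basis has monic elements and no monomial in the support of $f_F$ other than $\mathbf{x}_F$ lies in $\operatorname{in}_\tau(I)$. $\operatorname{Proj}S/I$ has codimension $n-2$ in $\mathbb{P}^{n-1}$. *)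

(* Defs.v *)
From HB Require Import structures.
From mathcomp Require Import all_boot all_order all_algebra.
From mathcomp Require Import mpoly.
Set Implicit Arguments. Unset Strict Implicit. Unset Printing Implicit Defensive.
Import Order.TTheory GRing.Theory.
Local Open Scope ring_scope.

Section Defs.
Variables (K : fieldType) (n : nat).
Notation poly := {mpoly K[n]}.
Notation monom := 'X_{1..n}.

Definition simplicial_complex (D : {set {set 'I_n}}) : Prop :=
  D != set0 /\ forall F G : {set 'I_n}, F \in D -> G \subset F -> G \in D.

Definition dim1 (D : {set {set 'I_n}}) : Prop :=
  (forall F, F \in D -> #|F| <= 2)%N /\ exists F, F \in D /\ #|F| = 2%N.

Definition maximal_face (D : {set {set 'I_n}}) (F : {set 'I_n}) : Prop :=
  F \in D /\ forall G, G \in D -> F \subset G -> G = F.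

Definition is_leaf (D : {set {set 'I_n}}) (v : 'I_n) : Prop :=
  exists F, [/\ maximal_face D F, v \in F &
             forall G, maximal_face D G -> v \in G -> G = F].

Definition minimal_nonface (D : {set {set 'I_n}}) (F : {set 'I_n}) : bool :=
  (F \notin D) && [forall G : {set 'I_n}, (G \proper F) ==> (G \in D)].

Definition mono (F : {set 'I_n}) : monom := [multinom (i \in F : nat) | i < n].

Definition is_ideal (I : poly -> Prop) : Prop :=
  [/\ I 0, forall f g, I f -> I g -> I (f + g) & forall h f, I f -> I (h * f)].

Definition ideal_gen (G : poly -> Prop) (p : poly) : Prop :=
  exists s : seq (poly * poly),
    (forall hg, hg \in s -> G hg.2) /\ p = \sum_(hg <- s) hg.1 * hg.2.

Definition hcomp (d : nat) (f : poly) : poly :=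
  \sum_(m <- msupp f | mdeg m == d) f@_m *: 'X_[m].

Definition homogeneous_ideal (I : poly -> Prop) : Prop :=
  forall f d, I f -> I (hcomp d f).

Definition SR_ideal (D : {set {set 'I_n}}) : poly -> Prop :=
  ideal_gen (fun p => exists F, F \notin D /\ p = 'X_[mono F]).

Definition monomial_order (le : rel monom) : Prop :=
  [/\ reflexive le, antisymmetric le, transitive le, total le &
    ((forall m1 m2 m, le m1 m2 -> le (mnm_add m1 m) (mnm_add m2 m)) /\
      (forall m, le (@mnm0 n) m))].

Definition is_lead (le : rel monom) (f : poly) (m : monom) : Prop :=
  m \in msupp f /\ forall m', m' \in msupp f -> le m' m.

Definition initial_ideal (le : rel monom) (I : poly -> Prop) : poly -> Prop :=
  ideal_gen (fun p => exists g m, [/\ I g, is_lead le g m & p = 'X_[m]]).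

End Defs.

(* Main.v *)
(* Dehomogenizing at x_1 turns the monomial order into a local order, since x_1
   is the largest variable.  Let b1, b2 be the two largest neighbours of the
   vertex 1.  The key point is that no homogeneous g in I whose linear part at
   P_1 involves no non-neighbour of 1 can involve x_b1 or x_b2 linearly: modulo
   the polynomials f_{1,d} (d a non-neighbour), which have invertible linear part
   in the x_d, a Mora-type reduction would make the leading monomial of g a face
   monomial.  Hence the linear parts of the f_F vanish at three independent
   vectors: e_1, and e_b corrected in the non-neighbour coordinates for b = b1, b2.

   Termination of the reduction comes from Dickson's lemma applied to the
   smallest leading monomials of such g, one for each large enough degree. *)

Require Import Defs.
From HB Require Import structures.
From mathcomp Require Import all_boot all_order all_algebra.
From mathcomp Require Import mpoly.
From Stdlib Require Import Classical ClassicalEpsilon.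
Set Implicit Arguments. Unset Strict Implicit. Unset Printing Implicit Defensive.
Import Order.TTheory GRing.Theory.
Local Open Scope ring_scope.

(** * Least elements, monotone subsequences and Dickson's lemma *)

Lemma exists_least_in_seq (T : eqType) (le : rel T) (s : seq T) (P : T -> Prop) :
  reflexive le -> transitive le -> total le ->
  (exists2 x, x \in s & P x) ->
  exists x, [/\ x \in s, P x & forall y, y \in s -> P y -> le x y].
Proof.
move=> le_refl le_trans le_total; elim: s => [|a s IHs] [x0]; first by rewrite in_nil.
rewrite inE => x0_in Px0.
case: (classic (exists2 x, x \in s & P x)) => [/IHs [x [xs Px x_min]]|no_x]; last first.
  have x0E : x0 = a.
    by case/predU1P: x0_in => // x0s; case: no_x; exists x0.
  exists a; split; [exact: mem_head | by rewrite -x0E |].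
  move=> y; rewrite inE => /predU1P [-> // | ys Py].
  by case: no_x; exists y.
case: (classic (P a /\ le a x)) => [[Pa le_ax]|not_a].
  exists a; split; [exact: mem_head | by [] |].
  move=> y; rewrite inE => /predU1P [-> // | ys Py].
  exact: le_trans le_ax (x_min y ys Py).
exists x; split=> //; first by rewrite inE xs orbT.
move=> y; rewrite inE => /predU1P [-> Pa | ys Py]; last exact: x_min.
by case/orP: (le_total x a) => // le_ax; case: not_a.
Qed.

(** Every tail of [u] attains its minimum; repeatedly picking a minimizer beyond the previous one
    gives the subsequence. *)
Lemma nondecreasing_subsequence (u : nat -> nat) :
  exists phi : nat -> nat, {homo phi : i j / (i < j)%N} /\
    {homo u \o phi : i j / (i <= j)%N}.
Proof.
have tail_min N : exists k, (N <= k)%N /\ forall j, (N <= j)%N -> (u k <= u j)%N.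
  (* Induction on a bound [v] for [u k]: either no value in the tail lies below the bound, so [k] is
     a minimizer, or such a value lowers the bound. *)
  suff H v : forall k, (N <= k)%N -> (u k <= v)%N ->
      exists k, (N <= k)%N /\ forall j, (N <= j)%N -> (u k <= u j)%N.
    exact: (H (u N) N).
  elim: v => [|v IHv] k Nk uk.
    by exists k; split=> // j _; apply: leq_trans uk _.
  case: (classic (exists2 j, (N <= j)%N & (u j <= v)%N)) => [[j Nj uj]|no_j].
    exact: IHv uj.
  exists k; split=> // j Nj; apply: (leq_trans uk); rewrite ltnNge.
  by apply/negP => uj; case: no_j; exists j.
pose c N := sval (constructive_indefinite_description _ (tail_min N)).
have [c_ge c_min] : (forall N, (N <= c N)%N) /\
    (forall N j, (N <= j)%N -> (u (c N) <= u j)%N).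
  by split=> N; rewrite /c; case: constructive_indefinite_description => k [].
pose phi i := iter i (fun k => c k.+1) (c 0%N).
have phi_lt : {homo phi : i j / (i < j)%N}.
  apply: homo_ltn => [x y z|i]; first exact: ltn_trans.
  by rewrite /phi iterS; apply: c_ge.
exists phi; split=> //; apply: homo_leq => [//|x y z|i]; first exact: leq_trans.
have lt_i := phi_lt i i.+1 (leqnn _).
case: i lt_i => [|i] lt_i; rewrite /=; apply: c_min => //.
by apply: leq_trans (ltnW lt_i); apply: c_ge.
Qed.

(** Passing to a subsequence once per variable makes all exponents nondecreasing; the first two
    terms then divide each other in order. *)
Lemma dickson n (s : nat -> 'X_{1..n}) :
  exists j k, (j < k)%N /\ (s j <= s k)%MM.
Proof.
have H (r : seq 'I_n) : exists phi : nat -> nat, {homo phi : i j / (i < j)%N} /\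
    forall a, a \in r -> {homo (fun k => s (phi k) a) : i j / (i <= j)%N}.
  elim: r => [|a r [phi [phi_lt phi_homo]]]; first by exists id; split.
  have [psi [psi_lt psi_homo]] := nondecreasing_subsequence (fun k => s (phi k) a).
  exists (phi \o psi); split=> [i j ij|b]; first by apply: phi_lt; apply: psi_lt.
  rewrite inE => /predU1P [-> i j ij | br i j ij]; first exact: psi_homo.
  apply: (phi_homo b br).
  by case: (ltngtP i j) ij => [/psi_lt/ltnW|//|->].
have [phi [phi_lt phi_homo]] := H (enum 'I_n).
exists (phi 0%N), (phi 1%N); split; first exact: phi_lt.
by apply/mnm_lepP => a; apply: (phi_homo a) => //; rewrite mem_enum.
Qed.

(** * Supports of monomials and membership in the Stanley-Reisner ideal *)

Definition msupport n (m : 'X_{1..n}) : {set 'I_n} := [set i | m i != 0%N].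

Lemma mem_msuppMX (R : nzRingType) n (p : {mpoly R[n]}) (q m : 'X_{1..n}) :
  (m \in msupp (p * 'X_[q])) = (q <= m)%MM && ((m - q)%MM \in msupp p).
Proof.
rewrite (perm_mem (msuppMX _ _)); apply/mapP/andP => [[m' m'p ->]|[qm mp]].
  by rewrite lem_addr addmC addmK.
by exists (m - q)%MM => //; rewrite addmC submK.
Qed.

Lemma mono_le n (F : {set 'I_n}) (m : 'X_{1..n}) :
  (mono F <= m)%MM = (F \subset msupport m).
Proof.
apply/mnm_lepP/subsetP => [H i iF|H i].
  by have := H i; rewrite mnmE iF inE -lt0n.
by rewrite mnmE; case: (boolP (i \in F)) => // /H; rewrite inE -lt0n.
Qed.

Lemma mdeg_mono n (F : {set 'I_n}) : mdeg (mono F) = #|F|.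
Proof.
rewrite mdegE -sum1_card [RHS]big_mkcond /=; apply: eq_bigr => i _.
by rewrite mnmE; case: (i \in F).
Qed.

(** Each monomial of [p] is divisible by some generator, so its support contains a non-face. *)
Lemma SR_ideal_msupport (K : fieldType) n (D : {set {set 'I_n}})
    (p : {mpoly K[n]}) (m : 'X_{1..n}) :
  (forall F G : {set 'I_n}, F \in D -> G \subset F -> G \in D) ->
  SR_ideal D p -> m \in msupp p -> msupport m \notin D.
Proof.
move=> D_down [s [sP ->]].
have [/hasP [[h g] hg_s /=]|] := boolP (has (fun hg => m \in msupp (hg.1 * hg.2)) s).
  have [F [FD /= ->]] := sP _ hg_s.
  rewrite mem_msuppMX mono_le => /andP [Fm _] _.
  by apply: contra FD => mD; apply: D_down mD Fm.
move=> /hasPn no_s; rewrite mcoeff_msupp raddf_sum big_seq big1 ?eqxx // => hg hg_s.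
by apply/eqP; rewrite mcoeff_eq0; apply: no_s.
Qed.

Lemma SR_idealX (K : fieldType) n (D : {set {set 'I_n}}) (m : 'X_{1..n}) :
  msupport m \notin D -> SR_ideal D ('X_[m] : {mpoly K[n]}).
Proof.
move=> mD; exists [:: ('X_[m - mono (msupport m)], 'X_[mono (msupport m)])]; split.
  by move=> hg; rewrite inE => /eqP ->; exists (msupport m).
by rewrite big_seq1 /= -mpolyXD submK // mono_le.
Qed.

Lemma mdegU_muln n (i : 'I_n) k : mdeg (U_(i) *+ k)%MM = k.
Proof. by rewrite mdegMn mdeg1 mul1n. Qed.

Lemma mnm_pure n (i : 'I_n) (m : 'X_{1..n}) :
  (forall j, j != i -> m j = 0%N) -> m = (U_(i) *+ mdeg m)%MM.
Proof.
move=> m0; have mE : m = (U_(i) *+ m i)%MM.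
  apply/mnmP => j; rewrite mulmnE mnm1E.
  by case: eqVneq => [->|]; rewrite ?mul1n // eq_sym => /m0 ->.
by rewrite {2}mE mdegU_muln.
Qed.

(** * Forms of the ideal near the coordinate point of the largest variable *)

Section PointAtTopVariable.
Variables (K : fieldType) (n : nat) (D : {set {set 'I_n.+1}}).
Variables (le : rel 'X_{1..n.+1}) (I : {mpoly K[n.+1]} -> Prop).
Hypothesis D_down : forall F G : {set 'I_n.+1}, F \in D -> G \subset F -> G \in D.
Hypothesis D_vertex : forall i : 'I_n.+1, [set i] \in D.
Hypothesis le_order : monomial_order le.
Hypothesis le_top : forall i : 'I_n.+1, le (U_(i))%MM (U_(ord0))%MM.
Hypothesis I_ideal : is_ideal I.
Hypothesis in_I : forall p, initial_ideal le I p <-> SR_ideal D p.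

Local Notation x0 := (@ord0 n).
(* The coefficient of a form g of degree e + 1 at T e i is the i-th partial
   derivative of g at P_1, provided g vanishes at P_1. *)
Local Notation T e i := (U_(x0) *+ e + U_(i))%MM.

Lemma le_mnmD m1 m2 m3 m4 : le m1 m2 -> le m3 m4 -> le (m1 + m3)%MM (m2 + m4)%MM.
Proof.
case: le_order => _ _ le_trans _ [le_add _] le12 le34.
apply: (le_trans (m2 + m3)%MM); first exact: le_add.
by rewrite ![(m2 + _)%MM]addmC; apply: le_add.
Qed.

(** Replacing the variables of [m] by [x0] one at a time never decreases the monomial. *)
Lemma le_x0_pow m : le m (U_(x0) *+ mdeg m)%MM.
Proof.
move: {2}(mdeg m) (erefl (mdeg m)) => d; elim: d m => [|d IHd] m md.
  rewrite md mulm0n; move/eqP: md; rewrite mdeg_eq0 => /eqP ->.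
  by case: le_order.
have /existsP [i mi] : [exists i, m i != 0%N].
  apply: contraPT md => /existsPn m0.
  by rewrite mdegE big1 // => i _; apply/eqP; have := m0 i; rewrite negbK.
have im : (U_(i) <= m)%MM by rewrite lep1mP.
have mE := submK im.
have md' : mdeg (m - U_(i)) = d.
  by apply/eqP; rewrite -eqSS -md -{2}mE mdegD mdeg1 addn1.
by rewrite md -{1}mE mulmSr; apply: le_mnmD => //; have := IHd _ md'; rewrite md'.
Qed.

Lemma is_lead_exists (p : {mpoly K[n.+1]}) : p != 0 -> exists m, is_lead le p m.
Proof.
case: le_order => le_refl _ le_trans le_total _ p0.
have [||||m [mp _ m_max]] := @exists_least_in_seq _ (fun x y => le y x) (msupp p) (fun=> True).
- by move=> m; apply: le_refl.
- by move=> a b c ba ac; apply: (le_trans a).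
- by move=> a b; apply: le_total.
- by exists (mlead p); first exact: mlead_supp.
by exists m; split=> // m' m'p; apply: m_max.
Qed.

Lemma is_lead_nonface g m : I g -> is_lead le g m -> msupport m \notin D.
Proof.
move=> Ig gm; apply: (@SR_ideal_msupport K _ _ 'X_[m]) => //; last by rewrite msuppX inE.
apply/in_I; exists [:: (1, 'X_[m])]; split; last by rewrite big_seq1 mul1r.
by move=> hg; rewrite inE => /eqP ->; exists g, m.
Qed.

Lemma msupport_sub (m : 'X_{1..n.+1}) i : (forall j, j != x0 -> j != i -> m j = 0%N) ->
  msupport m \subset [set x0; i].
Proof.
move=> m0; apply/subsetP => j; rewrite !inE; apply: contraR.
by rewrite negb_or => /andP [j0 ji]; rewrite m0.
Qed.

Lemma T_off e i j : j != x0 -> j != i -> T e i j = 0%N.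
Proof. by move=> j0 ji; rewrite mnmDE mulmnE !mnm1E ![_ == j]eq_sym (negbTE j0) (negbTE ji). Qed.

(** This is the vanishing of [g] at P_1: a power of [x0] is the largest monomial of its degree, so
    it would lead [g], yet its support is a face. *)
Lemma mcoeff_x0_pow g d : I g -> g \is d.-homog -> g@_(U_(x0) *+ d) = 0.
Proof.
move=> Ig /dhomogP g_hom; apply/eqP; rewrite mcoeff_eq0; apply/negP => in_g.
have /negP[] : msupport (U_(x0) *+ d)%MM \notin D.
  apply: (is_lead_nonface Ig); split=> // m mg.
  by have := le_x0_pow m; have /= -> := g_hom m mg.
apply: D_down (D_vertex x0) _; apply/subsetP => i.
by rewrite !inE mulmnE mnm1E [x0 == i]eq_sym; case: (i == x0); rewrite ?mul0n.
Qed.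

(** Both [g] and the monomial [q] vanish at P_1, so their product vanishes there to order two and
    has no linear part. *)
Lemma mcoeff_T_shift g q d e i : I g -> g \is d.-homog -> q != (U_(x0) *+ mdeg q)%MM ->
  (d + mdeg q = e.+1)%N -> (g * 'X_[q])@_(T e i) = 0.
Proof.
move=> Ig g_hom q_pure dq; apply/eqP; rewrite mcoeff_eq0 mem_msuppMX.
apply/negP => /andP [qT]; set m := (_ - q)%MM => mg.
have mE : (m + q)%MM = T e i by rewrite submK.
have [j j0 qj] : exists2 j, j != x0 & q j != 0%N.
  case: (pickP [pred j | (j != x0) && (q j != 0%N)]) => [j /andP []|no_j]; first by exists j.
  case/eqP: q_pure; apply: mnm_pure => j j0.
  by apply/eqP; have := no_j j; rewrite /= j0 /= => /negbFE.
have ji : j = i.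
  apply: contraNeq qj => ji; move/mnmP: (mE) => /(_ j).
  by rewrite T_off // mnmDE => /eqP; rewrite addn_eq0 => /andP [].
have m_pure : m = (U_(x0) *+ mdeg m)%MM.
  apply: mnm_pure => k k0; move/mnmP: (mE) => /(_ k).
  case: (eqVneq k i) => [->|ki]; last first.
    by rewrite T_off // mnmDE => /eqP; rewrite addn_eq0 => /andP [/eqP].
  rewrite !mnmDE mulmnE !mnm1E eqxx -ji eq_sym (negbTE j0) /=.
  by move: qj; case: (q j) => // a _; rewrite addnS => -[] /eqP; rewrite addn_eq0 => /andP [/eqP].
have md : mdeg m = d by have /dhomogP/(_ m mg) := g_hom.
by move: mg; rewrite m_pure md mcoeff_msupp mcoeff_x0_pow // eqxx.
Qed.


Lemma is_leadMX (g : {mpoly K[n.+1]}) m q : is_lead le g m -> is_lead le (g * 'X_[q]) (m + q)%MM.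
Proof.
case: le_order => le_refl _ _ _ _ [mg m_max]; split=> [|m'].
  by rewrite mem_msuppMX lem_addl addmK.
rewrite mem_msuppMX => /andP [qm' m'g]; rewrite -(submK qm').
by apply: le_mnmD (le_refl _); apply: m_max.
Qed.

(* The linear part of g at P_1 involves x_b but no non-neighbour of x0. *)
Definition tangent_at b e (g : {mpoly K[n.+1]}) := [/\ I g, g \is e.+1.-homog,
  forall d, [set x0; d] \notin D -> g@_(T e d) = 0 & g@_(T e b) != 0].

(** Multiplying by [x0] does not change the dehomogenization, hence not the linear part. *)
Lemma tangent_at_mulX0 b e g : tangent_at b e g -> tangent_at b e.+1 (g * 'X_[U_(x0)]).
Proof.
have T_S i : T e.+1 i = (U_(x0) + T e i)%MM by rewrite mulmS -addmA.
case=> Ig g_hom g_non g_b; case: I_ideal => _ _ I_mul; split.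
- by rewrite mulrC; apply: I_mul.
- by rewrite -[e.+2]addn1; apply: dhomogM => //; rewrite dhomogX /= mdeg1.
- by move=> d dD; rewrite T_S mcoeffMX g_non.
- by rewrite T_S mcoeffMX.
Qed.

(** * Excluding linear parts by reduction of leading monomials *)

Section Tangent.
Variables (b : 'I_n.+1) (h : 'I_n.+1 -> {mpoly K[n.+1]}).
Hypothesis b_edge : [set x0; b] \in D.
(** At most one neighbour of [x0] exceeds [b]; this form covers the largest and the second largest
    neighbour at once. *)
Hypothesis b_top : forall c c' : 'I_n.+1, c != x0 -> c' != x0 -> c != c' ->
  [set x0; c] \in D -> [set x0; c'] \in D ->
  le (U_(c))%MM (U_(b))%MM \/ le (U_(c'))%MM (U_(b))%MM.
Hypothesis hP : forall d, [set x0; d] \notin D ->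
  [/\ I (h d), h d \is 2.-homog & is_lead le (h d) (U_(x0) + U_(d))%MM].

(* A leading monomial supported on the star of x0 would involve two distinct
   neighbours, one of them at most x_b, so it would lie below T e b. *)
Lemma tangent_lead e g m : tangent_at b e g -> is_lead le g m ->
  exists d, [/\ [set x0; d] \notin D, m d != 0%N & m != T e d].
Proof.
move=> [Ig g_hom g_non g_b] [mg m_max].
have mD := is_lead_nonface Ig (conj mg m_max).
have m_deg : mdeg m = e.+1 by have /dhomogP/(_ m mg) := g_hom.
case: (pickP [pred d | ([set x0; d] \notin D) && (m d != 0%N)]) => [d /andP [dD md]|m_nbr].
  exists d; split=> //; apply: contraL mg => /eqP ->.
  by rewrite mcoeff_msupp g_non // eqxx.
have edge j : m j != 0%N -> [set x0; j] \in D.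
  by move=> mj; have := m_nbr j; rewrite /= mj andbT => /negbFE.
have [c c0 mc] : exists2 c, c != x0 & m c != 0%N.
  case: (pickP [pred j | (j != x0) && (m j != 0%N)]) => [j /andP []|no_j]; first by exists j.
  case/negP: mD; apply: D_down b_edge _; apply: msupport_sub => j j0 _.
  by apply/eqP; have := no_j j; rewrite /= j0 /= => /negbFE.
have [c' [c'0 cc' mc']] : exists c', [/\ c' != x0, c != c' & m c' != 0%N].
  case: (pickP [pred j | [&& j != x0, c != j & m j != 0%N]]) => [j /and3P []|no_j].
    by exists j.
  case/negP: mD; apply: D_down (edge c mc) _; apply: msupport_sub => j j0 jc.
  by apply/eqP; have := no_j j; rewrite /= j0 eq_sym jc /= => /negbFE.
have [a ma le_ab] : exists2 a, m a != 0%N & le (U_(a))%MM (U_(b))%MM.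
  by case: (b_top c0 c'0 cc' (edge _ mc) (edge _ mc')); [exists c | exists c'].
have aE : (m - U_(a) + U_(a))%MM = m by rewrite submK // lep1mP.
have le_mT : le m (T e b).
  rewrite -aE; apply: le_mnmD => //.
  suff <- : mdeg (m - U_(a)) = e by apply: le_x0_pow.
  by apply/eqP; rewrite -eqSS -m_deg -{2}aE mdegD mdeg1 addn1.
case: le_order => _ le_anti _ _ _.
have mT : m = T e b by apply: le_anti; rewrite le_mT m_max // mcoeff_msupp.
case/negP: mD; apply: D_down b_edge _; apply: msupport_sub => j j0 jb.
by rewrite mT T_off.
Qed.

(** If [h'] had no linear part, subtracting a multiple of it from [g] would cancel [m] and keep the
    linear part, giving a form of the same kind with a smaller leading monomial. *)
Lemma tangent_reduce e g h' m : tangent_at b e g -> is_lead le g m ->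
  (forall g' m', tangent_at b e g' -> is_lead le g' m' -> le m m') ->
  I h' -> h' \is e.+1.-homog -> is_lead le h' m -> ~ (forall i, h'@_(T e i) = 0).
Proof.
move=> [Ig g_hom g_non g_b] [mg m_max] m_min Ih h_hom [mh h_max] h_T.
case: I_ideal => _ I_add I_mul; case: le_order => le_refl le_anti _ _ _.
pose c := g@_m / h'@_m; pose r := g + (- c)%:MP * h'.
have rE k : r@_k = g@_k - c * h'@_k by rewrite mcoeffD mcoeffCM mulNr.
have r_tan : tangent_at b e r.
  split; first by apply: I_add => //; apply: I_mul.
  - by apply: rpredD => //; rewrite mul_mpolyC; apply: rpredZ.
  - by move=> d dD; rewrite rE h_T g_non // mulr0 subr0.
  - by rewrite rE h_T mulr0 subr0.
have [|m' r_lead] := @is_lead_exists r.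
  by apply: contraNneq g_b => r0; case: r_tan => _ _ _; rewrite r0 mcoeff0 eqxx.
have r_m : r@_m = 0 by rewrite rE /c divfK ?subrr // -mcoeff_msupp.
have le_mm' := m_min _ _ r_tan r_lead; case: r_lead => m'r _.
have le_m'm : le m' m.
  move: m'r; rewrite mcoeff_msupp rE.
  have [/h_max // | m'h] := boolP (m' \in msupp h').
  rewrite (memN_msupp_eq0 m'h) mulr0 subr0 -mcoeff_msupp; exact: m_max.
have m'E : m' = m by apply: le_anti; rewrite le_m'm le_mm'.
by move: m'r; rewrite m'E mcoeff_msupp r_m eqxx.
Qed.

Lemma tangent_min_lead e g : tangent_at b e g ->
  exists m, (exists2 g', tangent_at b e g' & is_lead le g' m) /\
    forall g' m', tangent_at b e g' -> is_lead le g' m' -> le m m'.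
Proof.
move=> g_tan; case: le_order => le_refl _ le_trans le_total _.
(* The strict bound [e.+2] admits all monomials of degree [e.+1], so the candidates form a finite
   list. *)
pose s := [seq bmnm m | m <- enum {: 'X_{1..n.+1 < e.+2}}].
have in_s g' m' : tangent_at b e g' -> is_lead le g' m' -> m' \in s.
  case=> _ /dhomogP g_hom _ _ [/g_hom /= m'_deg _].
  have lt_m' : (mdeg m' < e.+2)%N by rewrite m'_deg.
  by apply/mapP; exists (BMultinom lt_m') => //; rewrite mem_enum.
have [|m [_ m_lead m_min]] := @exists_least_in_seq _ le s
    (fun m => exists2 g', tangent_at b e g' & is_lead le g' m) le_refl le_trans le_total.
  have [|m g_lead] := @is_lead_exists g.
    by apply: contraTneq isT => g0; case: g_tan => _ _ _; rewrite g0 mcoeff0 eqxx.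
  by exists m; [apply: in_s g_lead | exists g].
by exists m; split=> // g' m' g'_tan g'_lead; apply: m_min; [apply: in_s g'_lead | exists g'].
Qed.

(** One such form yields others in all higher degrees. Among the least leading monomials [s k], one
    per degree, some [s j] divides a later [s k], and this produces a form without linear part whose
    leading monomial is [s k], against [tangent_reduce]. *)
Lemma tangent_empty e g : ~ tangent_at b e g.
Proof.
move=> g_tan.
have tan_ex k : exists g', tangent_at b (e + k) g'.
  elim: k => [|k [g' g'_tan]]; first by exists g; rewrite addn0.
  by exists (g' * 'X_[U_(x0)]); rewrite addnS; apply: tangent_at_mulX0.
have lead_ex k : exists m, (exists2 g', tangent_at b (e + k) g' & is_lead le g' m) /\
    forall g' m', tangent_at b (e + k) g' -> is_lead le g' m' -> le m m'.
  by have [g' /tangent_min_lead] := tan_ex k.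
pose s k := sval (constructive_indefinite_description _ (lead_ex k)).
have sP k : (exists2 g', tangent_at b (e + k) g' & is_lead le g' (s k)) /\
    forall g' m', tangent_at b (e + k) g' -> is_lead le g' m' -> le (s k) m'.
  by rewrite /s; case: constructive_indefinite_description.
have [j [k [jk s_jk]]] := dickson s.
have [[gj gj_tan gj_lead] _] := sP j; have [[gk gk_tan gk_lead] k_min] := sP k.
case: I_ideal => _ _ I_mul.
have [Igj gj_hom _ _] := gj_tan; have [Igk gk_hom _ _] := gk_tan.
have sj_deg : mdeg (s j) = (e + j).+1 by case: gj_lead => /(dhomogP _ _ _ gj_hom).
have sk_deg : mdeg (s k) = (e + k).+1 by case: gk_lead => /(dhomogP _ _ _ gk_hom).
have sE := submK s_jk; set q := (s k - s j)%MM in sE.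
have q_deg : (mdeg q + (e + j).+1 = (e + k).+1)%N by rewrite -sj_deg -sk_deg -mdegD sE.
(* If s k is not s j times a power of x0, the multiple of gj with leading
   monomial s k has no linear part; otherwise x0 divides s k, and a multiple of
   some h d reduces gk instead. *)
have [q_pure|q_pure] := eqVneq q (U_(x0) *+ mdeg q)%MM; last first.
  apply: (tangent_reduce gk_tan gk_lead k_min (h' := gj * 'X_[q])).
  - by rewrite mulrC; apply: I_mul.
  - by rewrite -q_deg addnC; apply: dhomogM => //; rewrite dhomogX /=.
  - by rewrite -sE addmC; apply: is_leadMX.
  - by move=> i; apply: mcoeff_T_shift gj_hom q_pure _ => //; rewrite addnC.
(* The degree of [q] is k - j > 0, so this pure power really contains [x0]. *)
have sk0 : s k x0 != 0%N.
  rewrite -sE mnmDE q_pure mulmnE mnm1E eqxx mul1n addn_eq0 negb_and; apply/orP; left.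
  by apply: contraTneq jk => q0; move: q_deg; rewrite q0 add0n => -[] /addnI ->; rewrite ltnn.
have [d [dD skd sk_T]] := tangent_lead gk_tan gk_lead.
have d0 : d != x0 by apply: contraNneq dD => ->; rewrite setUid.
have [Ih h_hom h_lead] := hP dD.
have x0d_sk : (U_(x0) + U_(d) <= s k)%MM.
  apply/mnm_lepP => i; rewrite mnmDE !mnm1E.
  have [<-|ix0] := eqVneq x0 i; first by rewrite (negbTE d0) lt0n.
  by have [<-|] := eqVneq d i; rewrite // lt0n.
have rE := submK x0d_sk; set r := (s k - _)%MM in rE.
have r_deg : (2 + mdeg r)%N = (e + k).+1 by rewrite -sk_deg -rE !mdegD !mdeg1 addnC.
apply: (tangent_reduce gk_tan gk_lead k_min (h' := h d * 'X_[r])).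
- by rewrite mulrC; apply: I_mul.
- by rewrite -r_deg; apply: dhomogM => //; rewrite dhomogX /=.
- by rewrite -rE addmC; apply: is_leadMX.
(* Were [r] a power of [x0], then [s k] would be [T (e + k) d], which [tangent_lead] rules out. *)
move=> i; apply: mcoeff_T_shift h_hom _ _ => //.
apply: contra sk_T => /eqP r_pure; rewrite -rE {1}r_pure addmA -mulmSr.
by case: r_deg => <-.
Qed.

End Tangent.
End PointAtTopVariable.

(** * Evaluation at a coordinate point, derivatives and homogeneous components *)

Lemma meval_coord_point (K : fieldType) n (p : {mpoly K[n]}) (i : 'I_n) :
  (forall d, p@_(U_(i) *+ d) = 0) -> p.@[fun j => (j == i)%:R] = 0.
Proof.
move=> p0; rewrite mevalE big1_seq // => m _.
case: (pickP [pred j | (j != i) && (m j != 0%N)]) => [j /andP [/negbTE ji mj]|m_i].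
  by rewrite (bigD1 j) //= ji expr0n (negbTE mj) mul0r mulr0.
rewrite (@mnm_pure _ i m) ?p0 ?mul0r // => j ji.
by apply/eqP; have := m_i j; rewrite /= ji /= => /negbFE.
Qed.

Lemma meval_coord_point_homog (K : fieldType) n (p : {mpoly K[n]}) (i : 'I_n) d :
  p \is d.-homog -> p.@[fun j => (j == i)%:R] = p@_(U_(i) *+ d).
Proof.
move=> p_hom; pose c := p@_(U_(i) *+ d).
have X_pt : 'X_[U_(i) *+ d].@[fun j => (j == i)%:R] = 1 :> K.
  rewrite mevalX big1 // => j _; rewrite mulmnE mnm1E eq_sym.
  by case: eqP; rewrite ?expr1n // mul0n expr0.
suff /eqP : (p - c *: 'X_[U_(i) *+ d]).@[fun j => (j == i)%:R] = 0.
  by rewrite mevalB mevalZ X_pt mulr1 subr_eq0 => /eqP.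
apply: meval_coord_point => e; rewrite mcoeffB mcoeffZ mcoeffX.
case: eqP => [<-|ne]; first by rewrite mulr1 subrr.
rewrite mulr0 subr0; apply: dhomog_nemf_coeff p_hom _.
by apply/eqP => /=; rewrite mdegU_muln => ed; case: ne; rewrite ed.
Qed.

Lemma dhomog_mderiv (K : fieldType) n (p : {mpoly K[n]}) (i : 'I_n) d :
  p \is d.+1.-homog -> p^`M(i) \is d.-homog.
Proof.
move=> /dhomogP p_hom; apply/dhomogP => m; rewrite mcoeff_msupp mcoeff_mderiv => pm.
have /p_hom /= : (m + U_(i))%MM \in msupp p.
  by rewrite mcoeff_msupp; apply: contraNneq pm => ->; rewrite mul0rn.
by rewrite mdegD mdeg1 addn1 => -[].
Qed.

Lemma mcoeff_hcomp (K : fieldType) n d (p : {mpoly K[n]}) m :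
  (hcomp d p)@_m = if mdeg m == d then p@_m else 0.
Proof.
rewrite raddf_sum big_mkcond /=.
have term0 m' : m' != m -> (if mdeg m' == d then (p@_m' *: 'X_[m'])@_m else 0) = 0.
  by move=> m'm; rewrite mcoeffZ mcoeffX (negbTE m'm) mulr0 if_same.
have [mp|mp] := boolP (m \in msupp p); last first.
  rewrite (memN_msupp_eq0 mp) if_same big1_seq // => m' m'p; apply: term0.
  by apply: contraNneq mp => <-; case/andP: m'p.
rewrite (bigD1_seq m) ?msupp_uniq //= big1 ?addr0.
  by rewrite mcoeffZ mcoeffX eqxx mulr1.
exact: term0.
Qed.

Lemma dhomog_hcomp (K : fieldType) n d (p : {mpoly K[n]}) : hcomp d p \is d.-homog.
Proof.
apply/dhomogP => m; rewrite mcoeff_msupp mcoeff_hcomp.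
by case: (eqVneq (mdeg m) d) => [md _|_]; [apply: md | rewrite eqxx].
Qed.

(** * Leaves and neighbours *)

(** Every face through [v] lies in the face {v, b}. The case b = v is included: then [v] is
    isolated. *)
Lemma is_leaf_unique_neighbour n (D : {set {set 'I_n}}) (v b : 'I_n) :
  (forall F G : {set 'I_n}, F \in D -> G \subset F -> G \in D) ->
  [set v; b] \in D -> (forall j, j != v -> [set v; j] \in D -> j = b) -> is_leaf D v.
Proof.
move=> D_down vb nbr.
have sub G : G \in D -> v \in G -> G \subset [set v; b].
  move=> GD vG; apply/subsetP => j jG; rewrite !inE.
  have [//|jv /=] := eqVneq j v; apply/eqP; apply: nbr => //.
  by apply: D_down GD _; rewrite subUset !sub1set vG.
have v_in : v \in [set v; b] by rewrite !inE eqxx.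
exists [set v; b]; split=> // [|G [GD G_max] vG]; last first.
  by apply/esym; apply: G_max => //; apply: sub.
split=> // G GD /[dup] vbG /subsetP/(_ v v_in) vG.
by apply/eqP; rewrite eqEsubset vbG andbT; apply: sub.
Qed.

Lemma two_largest_neighbours n (D : {set {set 'I_n}}) (v : 'I_n) (r : rel 'I_n) :
  (forall F G : {set 'I_n}, F \in D -> G \subset F -> G \in D) -> [set v] \in D ->
  reflexive r -> transitive r -> total r -> ~ is_leaf D v ->
  exists b1 b2, [/\ [/\ b1 != v, b2 != v & b1 != b2],
    [set v; b1] \in D, [set v; b2] \in D, r b2 b1 &
    forall c, c != v -> [set v; c] \in D -> c != b1 -> r c b2].
Proof.
move=> D_down vD r_refl r_trans r_total no_leaf.
have largest (P : pred 'I_n) : (exists j, P j) ->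
    exists b, P b /\ forall j, P j -> r j b.
  case=> j Pj; have [||||b [_ Pb b_max]] :=
    @exists_least_in_seq _ (fun x y => r y x) (enum 'I_n) P.
  - exact: r_refl.
  - by move=> x y z xy zx; apply: r_trans zx xy.
  - by move=> x y; apply: r_total.
  - by exists j; rewrite ?mem_enum.
  by exists b; split=> // k; apply: b_max; rewrite mem_enum.
(* Used at b = v for a first neighbour and at [b1] for a second one. *)
have other b : [set v; b] \in D -> exists j, [&& j != v, [set v; j] \in D & j != b].
  move=> vb; apply/existsP; apply: contraPT no_leaf => /existsPn no_j; rewrite /not; apply.
  apply: (is_leaf_unique_neighbour D_down vb) => j jv vj.
  by have := no_j j; rewrite jv vj /= negbK => /eqP.
have [|b1 [/andP [b1v vb1] b1_max]] :=
    largest (fun j => (j != v) && ([set v; j] \in D)).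
  by have [|j /and3P [jv vj _]] := other v; [rewrite setUid | exists j; rewrite jv].
have [b2 [/and3P [b2v vb2 b21] b2_max]] := largest _ (other b1 vb1).
exists b1, b2; split=> //; first by rewrite b1v b2v eq_sym.
  by apply: b1_max; rewrite b2v.
by move=> c cv vc cb1; apply: b2_max; rewrite cv vc.
Qed.

(** * The point P_1 and the rank of the Jacobian matrix *)

(* Variables are x_1, ..., x_{n+1}, indexed by 'I_n.+1; vertex/variable 1
   is ord0, and P_1 = [1:0:...:0]. *)
Theorem theorem4p9 (K : fieldType) (n : nat)
  (D : {set {set 'I_n.+1}})
  (le : rel 'X_{1..n.+1})
  (I : {mpoly K[n.+1]} -> Prop)
  (f : {set 'I_n.+1} -> {mpoly K[n.+1]}) :
  simplicial_complex D -> dim1 D ->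
  (forall i : 'I_n.+1, [set i] \in D) ->
  monomial_order le ->
  (forall i : 'I_n.+1, le (U_(i))%MM (U_(ord0))%MM) ->
  is_ideal I -> homogeneous_ideal I ->
  (forall p, initial_ideal le I p <-> SR_ideal D p) ->
  (forall F, minimal_nonface D F ->
     [/\ I (f F), (exists d, f F \is d.-homog),
         is_lead le (f F) (mono F), (f F)@_(mono F) = 1 &
         forall m, m \in msupp (f F) -> m != mono F ->
           ~ initial_ideal le I 'X_[m]]) ->
  ~ is_leaf D ord0 ->
  let P1 := fun i : 'I_n.+1 => (i == ord0)%:R : K in
  (forall p, I p -> p.@[P1] = 0) /\
  (\rank (\matrix_(k < #|[set F | minimal_nonface D F]|, i < n.+1)
            ((f (enum_val k))^`M(i)).@[P1]) <= n.+1 - 3)%N.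
Proof.
move=> [_ D_down] _ D_vertex le_order le_top I_ideal I_hom in_I fP no_leaf P1.
have coef_x0 := mcoeff_x0_pow D_down D_vertex le_order le_top in_I.
split=> [p Ip|].
  apply: meval_coord_point => d.
  have := coef_x0 _ d (I_hom p d Ip) (dhomog_hcomp d p).
  by rewrite mcoeff_hcomp mdegU_muln eqxx.
set M := \matrix_(k, i) _.
pose T e i := (U_(@ord0 n) *+ e + U_(i))%MM.
have card_nonface (F : {set 'I_n.+1}) : F \notin D -> (1 < #|F|)%N.
  move=> FD; rewrite ltnNge; apply: contra FD => F1.
  have [->|[i iF]] := set_0Vmem F; first by apply: D_down (D_vertex ord0) (sub0set _).
  apply: D_down (D_vertex i) _; apply/subsetP => j jF; rewrite inE.
  exact/eqP/(card_le1_eqP F1).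
have min_pair d : [set ord0; d] \notin D -> minimal_nonface D [set ord0; d].
  move=> dD; rewrite /minimal_nonface dD; apply/forallP => G; apply/implyP => Gd.
  apply: contraTT (proper_card Gd) => /card_nonface G2.
  by rewrite -leqNgt cards2; apply: leq_trans G2; case: (_ != _).
have f_hom F : minimal_nonface D F -> f F \is #|F|.-homog.
  move=> /fP [_ [d f_hom] [f_mono _] _ _].
  have d_mono : mdeg (mono F) = d by have /dhomogP/(_ _ f_mono) := f_hom.
  by rewrite -mdeg_mono d_mono.
(* Reducedness: the monomials of [f F] other than the leading one are supported on faces. *)
have f_std F m : minimal_nonface D F -> m != mono F -> msupport m \notin D ->
    (f F)@_m = 0.
  move=> /fP [_ _ _ _ f_red] mF mD; apply/eqP; rewrite mcoeff_eq0; apply/negP => mf.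
  by apply: f_red mf mF _; apply/in_I; apply: SR_idealX.
have T_inj e i j : T e i = T e j -> i = j.
  by move/addmI/mnmP/(_ j); rewrite !mnm1E eqxx; case: eqP.
have T_nonface e d : [set ord0; d] \notin D -> msupport (T e.+1 d) \notin D.
  move=> dD; apply: contra dD => mD; apply: D_down mD _.
  rewrite subUset !sub1set !inE !mnmDE !mulmnE !mnm1E !eqxx mul1n /=.
  by rewrite addn1.
have nbr0 (d : 'I_n.+1) : [set ord0; d] \notin D -> d != ord0.
  by apply: contraNneq => ->; rewrite setUid.
have mono_pair d : [set ord0; d] \notin D -> mono [set ord0; d] = T 1 d.
  move=> /nbr0 d0; apply/mnmP => j; rewrite mnmE !inE mnmDE mulm1n !mnm1E ![_ == j]eq_sym.
  by case: eqVneq => // ->; rewrite eq_sym (negbTE d0).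
(* In the non-neighbour variables, the linear part of the polynomial of the pair {1, d} is exactly
   x_d. *)
have f_pair d i : [set ord0; d] \notin D -> [set ord0; i] \notin D ->
    (f [set ord0; d])@_(T 1 i) = (i == d)%:R.
  move=> dD iD; have dmin := min_pair d dD; have [_ _ _ f1 _] := fP _ dmin.
  have [->|id] := eqVneq i d; first by rewrite -mono_pair.
  apply: f_std => //; last exact: T_nonface.
  by rewrite mono_pair //; apply: contraNneq id => /T_inj ->.
pose U i j := le (U_(i))%MM (U_(j))%MM.
have [||||b1 [b2 [[b10 b20 b12] b1D b2D le_b21 b2_max]]] :=
  @two_largest_neighbours _ D ord0 U D_down (D_vertex _).
- by case: le_order => le_refl _ _ _ _ i; rewrite /U.
- by case: le_order => _ _ le_trans _ _ x y z; rewrite /U; apply: le_trans.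
- by case: le_order => _ _ _ le_total _ x y; rewrite /U.
- exact: no_leaf.
have no_tangent b e g : b \in [:: b1; b2] -> ~ tangent_at D I b e g.
  move=> b_in; apply: (tangent_empty D_down D_vertex le_order le_top I_ideal in_I _ _
    (h := fun d => f [set ord0; d])).
  - by move: b_in; rewrite !inE => /orP [] /eqP ->.
  - have b2b : U b2 b.
      by move: b_in; rewrite !inE => /orP [] /eqP -> //; case: le_order => le_refl _ _ _ _; rewrite /U.
    case: le_order => _ _ le_trans _ _.
    (* Of two distinct neighbours one differs from [b1], so it is at most [b2], which is at most
       [b]. *)
    move=> c c' c0 c'0 cc' cD c'D; have [cb1|cb1] := eqVneq c b1; [right|left].
      by apply: le_trans b2b; apply: b2_max; rewrite // -cb1 eq_sym.
    by apply: le_trans b2b; apply: b2_max.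
  move=> d dD; have dmin := min_pair d dD; have [If _ f_lead _ _] := fP _ dmin.
  have := f_hom _ dmin; rewrite cards2 eq_sym nbr0 // => f2.
  by move: f_lead; rewrite mono_pair.
(* For i = [ord0] the derivative brings in a factor |F|, but the coefficient of x_1^|F| is zero, so
   both sides vanish. *)
have M_entry k i : let F := enum_val k in M k i = (f F)@_(T #|F|.-1 i).
  move=> F; have := enum_valP k; rewrite inE -/F => Fmin.
  have Fcard : (#|F| = #|F|.-1.+1)%N by rewrite prednK // ltnW // card_nonface //; case/andP: Fmin.
  have := f_hom F Fmin; rewrite {1}Fcard => Fhom.
  have [If _ _ _ _] := fP F Fmin.
  rewrite mxE -/F (@meval_coord_point_homog _ _ _ ord0 #|F|.-1) ?dhomog_mderiv // mcoeff_mderiv.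
  rewrite mulmnE mnm1E; have [<-|i0] := eqVneq ord0 i; last by rewrite mul0n.
  by rewrite /T -mulmSr coef_x0 ?mul0rn.
pose bs := [tuple ord0; b1; b2].
have bs_uniq : uniq bs by rewrite /= !inE negb_or ![ord0 == _]eq_sym b10 b20 b12.
have bs_nbr k : [set ord0; tnth bs k] \in D.
  have: tnth bs k \in bs by apply: mem_tnth.
  by rewrite !inE => /or3P [] /eqP -> //; rewrite setUid.
(* w i b is the i-th coordinate of e_b - \sum_d (d f_{0,d} / d x_b)(P1) e_d,
   where d runs over the non-neighbours of ord0. *)
pose w (i b : 'I_n.+1) : K :=
  (i == b)%:R - (if [set ord0; i] \in D then 0 else (f [set ord0; i])@_(T 1 b)).
pose V : 'M[K]_(n.+1, 3) := \matrix_(i, k) w i (tnth bs k).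
(* The corrections affect only non-neighbour coordinates, so the rows of [V] at [ord0], [b1], [b2]
   form the identity. *)
have V_rank : (3 <= \rank V)%N.
  pose P : 'M[K]_(3, n.+1) := \matrix_(k, i) (i == tnth bs k)%:R.
  suff PV : P *m V = 1%:M by have := mxrankM_maxr P V; rewrite PV mxrank1.
  apply/matrixP => k l; rewrite !mxE (bigD1 (tnth bs k)) //= big1 => [|i /negbTE ik].
    rewrite !mxE /w bs_nbr eqxx mul1r subr0 addr0.
    by rewrite !(tnth_nth ord0) nth_uniq.
  by rewrite mxE ik mul0r.
suff MV : M *m V = 0.
  rewrite leq_subRL; last by apply: leq_trans V_rank (rank_leq_row _).
  by apply: leq_trans (mulmx0_rank_max MV); rewrite addnC leq_add2l.
apply/matrixP => k l; rewrite [RHS]mxE mxE; set b := tnth bs l.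
set F := enum_val k; have := enum_valP k; rewrite inE -/F => Fmin.
have [If _ _ _ _] := fP F Fmin; have Fhom := f_hom F Fmin.
pose L i := (f F)@_(T #|F|.-1 i).
(* The linear part [L] of [f F] kills the corrected vector of [b]. *)
suff L_sum : \sum_i L i * (if [set ord0; i] \in D then 0
    else (f [set ord0; i])@_(T 1 b)) = L b.
  under eq_bigr => i _ do rewrite M_entry mxE mulrBr -/b.
  rewrite sumrB L_sum (bigD1 b) //= eqxx mulr1 big1 ?addr0 ?subrr // => i /negbTE ->.
  by rewrite mulr0.
have FD : F \notin D by case/andP: Fmin.
(* For F = {1, d} only the term i = d survives, and it equals [L b]. For any other F, [L] vanishes
   on the non-neighbours, so [L b] must be zero: by [no_tangent], or by vanishing at P_1 when b =
   [ord0]. *)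
have [d Fd|F_pair] := pickP [pred d | F == [set ord0; d]].
  move/eqP: Fd => /= Fd; rewrite Fd in FD.
  have LE i : L i = (f [set ord0; d])@_(T 1 i).
    by rewrite /L Fd cards2 eq_sym nbr0.
  rewrite (bigD1 d) //= (negbTE FD) !LE f_pair // eqxx mul1r big1 ?addr0 // => i id.
  by case: ifPn => [_|iD]; rewrite ?mulr0 // LE f_pair // (negbTE id) mul0r.
have [e FE] : exists e, #|F| = e.+2.
  by move: (card_nonface F FD); case: #|F| => [|[|e]] // _; exists e.
have L0 i : [set ord0; i] \notin D -> L i = 0.
  move=> iD; rewrite /L FE; apply: f_std => //; last exact: T_nonface.
  apply: contraFneq (F_pair i) => T_F /=.
  have F_sub : F \subset [set ord0; i].
    have -> : F = msupport (T e.+1 i).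
      by rewrite [T _ _]T_F; apply/setP => j; rewrite inE mnmE; case: (j \in F).
    by apply: msupport_sub => j; apply: T_off.
  by rewrite eqEcard F_sub cards2 FE; case: (_ != _).
rewrite big1 => [|i _]; last by case: ifPn => [_|iD]; rewrite ?mulr0 // L0 ?mul0r.
apply/esym/eqP; have [->|b0] := eqVneq b ord0.
  by rewrite /L /T -mulmSr coef_x0 //; move: Fhom; rewrite FE.
apply/negPn/negP => Lb; apply: (no_tangent b e.+1 (f F)).
  by have := mem_tnth l bs; rewrite !inE (negbTE b0).
split=> //; [by rewrite -FE | | by move: Lb; rewrite /L FE].
by move=> d /L0; rewrite /L FE.
Qed.
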